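(* Consider the stochastic process (case 3) describing transmission of photons through a sequence of $M\ge 1$ identical polarization sensitive elements rotated by angles $\vec\alpha=(\alpha_0,\dots,\alpha_{M-1})$, with $N_0\neq 0$ initial photons, with common transmission probability $P_T(\theta_{\mathrm{in}},\alpha)$ and common change density $\rho_{\widetilde C}(\theta_{\mathrm{out}},\alpha)$ (not depending on the incoming angle), as defined in the context. Then for every $i\in(0,\dots,M-1)$, $$\frac{N_{i+1}(\vec\alpha)}{N_0}\,\rho_{S,i+1}(\theta_{i+1},\vec\alpha)=\rho_{\widetilde C}(\theta_{i+1},\alpha_i)\left[\int_{\theta_0}\rho_{S,0}(\theta_0,\vec\alpha)\,P_T(\theta_0,\alpha_0)\,\mathrm{d}\theta_0\right]\prod_{j=1}^{i}\left[\int_{\theta_j}\rho_{\widetilde C}(\theta_j,\alpha_{j-1})\,P_T(\theta_j,\alpha_j)\,\mathrm{d}\theta_j\right],$$ where the product $\prod_{j=1}^{i}[\dots]$ equals $1$ if $i=0$.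
   Context: Process ''case 3''. Photons pass successively through surfaces $\Sigma_0,\dots,\Sigma_M$; the $i$-th polarization sensitive element ($i=0,\dots,M-1$) lies between $\Sigma_i$ and $\Sigma_{i+1}$ and is rotated by a fixed (non-random) angle $\alpha_i$; $\vec\alpha=(\alpha_0,\dots,\alpha_{M-1})$. The state of a photon at $\Sigma_i$ is a random polarization angle $\theta_i$, ranging over a fixed interval of length $2\pi$ with Lebesgue measure $\mathrm{d}\theta_i$; $\int_{\theta_i}$ denotes integration over this interval. $N_0>0$ photons pass through $\Sigma_0$; different photons are independent. The data are: - $\rho_{S,0}(\theta_0,\vec\alpha)$: the probability density of $\theta_0$ (it does not depend on the element rotations). - $P_{T,i}(\theta_i,\alpha_i)\in[0,1]$, measurable: the conditional probability that a photon with polarization angle $\theta_i$ at $\Sigma_i$ is transmitted through the $i$-th element (otherwise it never reaches $\Sigma_{i+1},\dots,\Sigma_M$). - $\rho_{C,i}(\theta_i,\theta_{i+1},\alpha_i)\ge 0$, jointly measurable in $(\theta_i,\theta_{i+1})$, with $\int_{\theta_{i+1}}\rho_{C,i}(\theta_i,\theta_{i+1},\alpha_i)\,\mathrm{d}\theta_{i+1}=1$ for all $\theta_i$: the conditional probability density of the outgoing polarization angle $\theta_{i+1}$, given the incoming angle $\theta_i$ and given that the photon was transmitted through the $i$-th element. In case 3 it is assumed that each $\rho_{C,i}$ does not depend on $\theta_i$ and that the elements are identical: there are functions $P_T(\theta_{\mathrm{in}},\alpha)$ and $\rho_{\widetilde C}(\theta_{\mathrm{out}},\alpha)$ such that $P_{T,i}(\theta_i,\alpha_i)=P_T(\theta_i,\alpha_i)$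 and $\rho_{C,i}(\theta_i,\theta_{i+1},\alpha_i)=\rho_{\widetilde C}(\theta_{i+1},\alpha_i)$ for all $i=0,\dots,M-1$. Memoryless (Markov) property: transmission through the $i$-th element and the resulting angle depend on the past only through $\theta_i$. Derived quantities: $N_i(\vec\alpha)$ is the (expected) number of photons which pass through $\Sigma_i$, i.e. $N_0$ times the probability that a photon reaches $\Sigma_i$ (so $N_0(\vec\alpha)=N_0$); $\rho_{S,i}(\theta_i,\vec\alpha)$ is the probability density of the polarization angle at $\Sigma_i$ conditioned on the photon reaching $\Sigma_i$ (both depend on $\vec\alpha$ at most through $\alpha_0,\dots,\alpha_{i-1}$). If $N_i(\vec\alpha)=0$, the product $N_i(\vec\alpha)\rho_{S,i}(\theta_i,\vec\alpha)$ is understood to be $0$. Identities between densities are understood almost everywhere. *)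

(* Defs.v *)
From HB Require Import structures.
From mathcomp Require Import all_boot all_order all_algebra.
From mathcomp Require Import all_classical all_reals all_analysis.

Set Implicit Arguments.
Unset Strict Implicit.
Unset Printing Implicit Defensive.

Import Order.TTheory GRing.Theory Num.Theory.
Import numFieldNormedType.Exports.

Local Open Scope classical_set_scope.
Local Open Scope ring_scope.

(** An interval of length [2 * pi] starting at [a].  The booleans choose which
    endpoints belong to it ([true false] is [a, a + 2 pi[). *)
Definition angles (R : realType) (bl br : bool) (a : R) : set R :=
  [set` Interval (BSide bl a) (BSide br (a + pi *+ 2))].

(** [PT t a] is the probability that a photon with angle [t] passes the element
    rotated by [a]; [rhoC t t' a] is the density at [t'] of the outgoing angle
    of a transmitted photon with incoming angle [t]. *)
Record polarization_element (R : realType) (D : set R)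
    (PT : R -> R -> R) (rhoC : R -> R -> R -> R) : Prop := {
  trans_measurable : forall a, measurable_fun D (PT^~ a) ;
  trans_prob : forall t a, D t -> 0 <= PT t a <= 1 ;
  change_measurable : forall a,
    measurable_fun (D `*` D) (fun p : R * R => rhoC p.1 p.2 a) ;
  change_ge0 : forall t t' a, D t -> D t' -> 0 <= rhoC t t' a ;
  change_int1 : forall t a, D t ->
    (\int[lebesgue_measure]_(t' in D) (rhoC t t' a)%:E = 1)%E
}.

Definition case3 (R : realType) (M : nat) (D : set R)
    (PTi : 'I_M -> R -> R -> R) (rhoCi : 'I_M -> R -> R -> R -> R)
    (PT rhoCt : R -> R -> R) : Prop :=
  (forall i t a, D t -> PTi i t a = PT t a) /\
  (forall i t t' a, D t -> D t' -> rhoCi i t t' a = rhoCt t' a).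

Section photons.
Context d (Omega : measurableType d) (R : realType).
Implicit Types (P : probability Omega R) (D : set R).
Implicit Types (reach : nat -> set Omega) (theta : nat -> Omega -> R).

(** For a single photon, [reach i] is the event that it passes through the
    [i]-th surface, and [theta i] its angle there.  [theta i] carries meaning on
    [reach i] only, and is never used outside of it. *)

Definition angle_event reach theta (i : nat) (B : set R) : set Omega :=
  reach i `&` theta i @^-1` B.

(** The sigma-algebra of the events describing the photon up to surface [i]. *)
Definition history reach theta (i : nat) : set (set Omega) :=
  <<s [set E | exists j B, [/\ (j <= i)%N, measurable B &
                               E = angle_event reach theta j B] ]>>.

Definition cond_prob P (A B : set Omega) : R :=
  fine (P (B `&` A)) / fine (P B).

(** [rho] is a density of the angle at surface [i], conditioned on reaching it.
    There is no constraint on [rho] if the surface is almost never reached. *)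
Definition state_density P D reach theta (i : nat) (rho : R -> R) : Prop :=
  P (reach i) != 0%E ->
  [/\ measurable_fun D rho,
      (forall t, D t -> 0 <= rho t) &
      forall B : set R, measurable B ->
        (cond_prob P (angle_event reach theta i B) (reach i))%:E =
        (\int[lebesgue_measure]_(t in D `&` B) (rho t)%:E)%E].

(** The process of one photon.  In [photon_transmission] and [photon_change] the
    conditional laws are given the whole history, in the form of their defining
    integral identities over all events [H] of the history; that they involve
    only the current angle [theta i] is the Markov property. *)
Record photon_process P D (M : nat)
    (PTi : 'I_M -> R -> R -> R) (rhoCi : 'I_M -> R -> R -> R -> R)
    (rhoS0 : R -> R) (alpha : M.-tuple R) reach theta : Prop := {
  reach_measurable : forall i, (i <= M)%N -> measurable (reach i) ;
  theta_measurable : forall i, (i <= M)%N ->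
    measurable_fun (reach i) (theta i) ;
  theta_range : forall i w, (i <= M)%N -> reach i w -> D (theta i w) ;
  reach0 : reach 0%N = setT ;
  reachS : forall i : 'I_M, reach i.+1 `<=` reach i ;
  photon_source : state_density P D reach theta 0 rhoS0 ;
  photon_transmission : forall (i : 'I_M) (H : set Omega),
    history reach theta i H ->
    P (H `&` reach i.+1) =
    (\int[P]_(w in H `&` reach i) (PTi i (theta i w) (alpha`_i))%:E)%E ;
  photon_change : forall (i : 'I_M) (H : set Omega) (B : set R),
    history reach theta i H -> measurable B ->
    P (H `&` angle_event reach theta i.+1 B) =
    (\int[P]_(w in H `&` reach i.+1)
       \int[lebesgue_measure]_(t in D `&` B)
         (rhoCi i (theta i w) t (alpha`_i))%:E)%E
}.

(** [N0] independent photons subject to the same data; [reach k] and [theta k]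
    describe the [k]-th one.  Taking some [E k] to be [setT] yields the product
    rule for subfamilies. *)
Record photon_beam P D (M N0 : nat)
    (PTi : 'I_M -> R -> R -> R) (rhoCi : 'I_M -> R -> R -> R -> R)
    (rhoS0 : R -> R) (alpha : M.-tuple R)
    (reach : 'I_N0 -> nat -> set Omega) (theta : 'I_N0 -> nat -> Omega -> R)
    : Prop := {
  beam_photon : forall k,
    photon_process P D PTi rhoCi rhoS0 alpha (reach k) (theta k) ;
  beam_independent : forall E : 'I_N0 -> set Omega,
    (forall k, history (reach k) (theta k) M (E k)) ->
    P (\bigcap_k E k) = (\prod_(k < N0) P (E k))%E
}.

(** Expected number of photons which pass through the [i]-th surface. *)
Definition expected_photons P (N0 : nat)
    (reach : 'I_N0 -> nat -> set Omega) (i : nat) : R :=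
  fine ('E_P[(fun w => \sum_(k < N0) \1_(reach k i) w)%R])%E.

End photons.

(* Main.v *)
Require Import Defs.
From HB Require Import structures.
From mathcomp Require Import all_boot all_order all_algebra.
From mathcomp Require Import all_classical all_reals all_analysis.
From mathcomp Require Import measurable_realfun.

Import Order.TTheory GRing.Theory Num.Theory.
Import numFieldNormedType.Exports.

Local Open Scope classical_set_scope.
Local Open Scope ring_scope.

(** Since the change density ignores the incoming angle, the Markov property makes
    the law of the angle on the event of reaching the surface [i.+1] equal to
    the probability of this event times [rhoCt _ alpha_i].  Integrating the
    transmission probability against this law (against [rhoS0] for the first
    element) shows that each element multiplies the probability of survival by
    one factor of the product.  This probability is therefore the same for all
    the photons, and uniqueness of densities identifies [rhoS i.+1] with
    [rhoCt _ alpha_i] whenever it is nonzero. *)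

(* Holds for infinite [x] as well, because [fine] sends both infinities to [0]. *)
Lemma fine_mulEFin (R : realType) (c : R) (x : \bar R) :
  fine (c%:E * x)%E = c * fine x.
Proof.
case: x => [r//||]; rewrite mulr_infty mulr0 /=.
  by case: sgrP => _; rewrite ?mul0e ?mul1e ?mulN1e.
by case: sgrP => _; rewrite ?mul0e ?mul1e ?mulN1e.
Qed.

(** * Integration against a law with a density *)

Section integral_of_density.
Context d1 d2 (X : measurableType d1) (Y : measurableType d2) (R : realType).
Variables (mu : {measure set X -> \bar R}) (nu : {measure set Y -> \bar R}).
Variables (A : set X) (D : set Y) (f : X -> Y) (g : Y -> R).
Hypotheses (mA : measurable A) (mD : measurable D) (mf : measurable_fun A f).
Hypotheses (fD : forall x, A x -> D (f x)) (mg : measurable_fun D g).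
Hypothesis g_ge0 : forall y, D y -> 0 <= g y.
Hypothesis law_density : forall B, measurable B ->
  mu (A `&` f @^-1` B) = (\int[nu]_(y in D `&` B) (g y)%:E)%E.

Import HBNNSimple.
Local Open Scope ereal_scope.

(** By linearity over the finitely many values of [h], this reduces to indicators of level sets, to
    which [law_density] applies. *)
Lemma integral_comp_density_nnsfun (h : {nnsfun Y >-> R}) :
  \int[mu]_(x in A) (h (f x))%:E = \int[nu]_(y in D) ((h y)%:E * (g y)%:E).
Proof.
have mI r : measurable_fun D (fun y => (\1_(h @^-1` [set r]) y)%:E : \bar R).
  exact/measurable_EFinP/measurable_funTS/measurable_indic.
have mIf r : measurable_fun A (fun x => (\1_(h @^-1` [set r]) (f x))%:E : \bar R).
  apply/measurable_EFinP.
  by apply: (measurable_comp measurableT) => //; exact: measurable_indic.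
have mG : measurable_fun D (EFin \o g) by exact/measurable_EFinP.
transitivity (\sum_(r \in range h)
    \int[mu]_(x in A) (r%:E * (\1_(h @^-1` [set r]) (f x))%:E)).
  rewrite -ge0_integral_fsum//.
  - by apply: eq_integral => x _; rewrite fimfunE -fsumEFin.
  - by move=> r; apply: measurable_funeM.
  - by move=> r x _; exact: nnfun_muleindic_ge0.
transitivity (\sum_(r \in range h)
    \int[nu]_(y in D) (r%:E * (\1_(h @^-1` [set r]) y)%:E * (g y)%:E));
    last first.
  rewrite -ge0_integral_fsum//.
  - apply: eq_integral => y _.
    rewrite -ge0_mule_fsuml => [|r]; last exact: nnfun_muleindic_ge0.
    by rewrite fimfunE -fsumEFin.
  - by move=> r; apply: emeasurable_funM => //; exact: measurable_funeM.
  - by move=> r y Dy; rewrite mule_ge0 ?nnfun_muleindic_ge0// lee_fin g_ge0.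
(* Only values of [h] occur in the sum, so [r] is nonnegative and can be pulled out of both
   integrals. *)
apply: eq_fsbigr => r; rewrite inE => -[y0 _ hr].
have r0 : 0 <= r%:E by rewrite lee_fin -hr.
rewrite ge0_integralZl//; under [RHS]eq_integral do rewrite -muleA.
rewrite ge0_integralZl//; last 2 first.
  - exact: emeasurable_funM.
  - by move=> y Dy; rewrite mule_ge0// lee_fin ?g_ge0.
congr (_ * _).
(* The left integral is the measure of the preimage under [f] of a level set, which [law_density]
   computes. *)
transitivity (mu (A `&` f @^-1` (h @^-1` [set r]))).
  rewrite -[in RHS](setIid A) -setIA setIC -integral_indic//=; last first.
    rewrite -/(f @^-1` _); exact: mf.
  apply: eq_integral => x; rewrite inE => Ax; congr EFin.
  by rewrite !indicE; congr (nat_of_bool _)%:R; apply/idP/idP; rewrite !inE /=; tauto.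
rewrite law_density// integral_mkcondr; apply: eq_integral => y _.
by rewrite muleC epatch_indic.
Qed.

(** Monotone convergence on both sides extends the simple case. The approximation of [h] converges
    on [D], which contains [f x] by [fD]. *)
Lemma integral_comp_density (h : Y -> R) :
  measurable_fun D h -> (forall y, D y -> (0 <= h y)%R) ->
  \int[mu]_(x in A) (h (f x))%:E = \int[nu]_(y in D) ((h y)%:E * (g y)%:E).
Proof.
move=> mh h0.
have mh' : measurable_fun D (EFin \o h) by exact/measurable_EFinP.
pose s := nnsfun_approx mD mh'.
have cvs y : D y -> EFin \o s^~ y @ \oo --> (h y)%:E.
  by move=> Dy; apply: (@cvg_nnsfun_approx _ _ _ _ mD _ mh').
transitivity (limn (fun n => \int[mu]_(x in A) (s n (f x))%:E)).
  rewrite -monotone_convergence//.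
  - apply: eq_integral => x; rewrite inE => Ax.
    by apply/esym/cvg_lim => //; exact/cvs/fD.
  - move=> n; apply/measurable_EFinP.
    by apply: (measurable_comp measurableT).
  - by move=> n x _; rewrite lee_fin.
  - by move=> x _ m n mn; rewrite lee_fin; exact/lefP/nd_nnsfun_approx.
under eq_fun do rewrite integral_comp_density_nnsfun.
rewrite -monotone_convergence//.
- apply: eq_integral => y; rewrite inE => Dy.
  by apply/cvg_lim => //; apply: cvgeZr => //; exact: cvs.
- move=> n; apply: emeasurable_funM; apply/measurable_EFinP => //.
  exact: measurable_funTS.
- by move=> n y Dy; rewrite mule_ge0// lee_fin ?g_ge0.
- move=> y Dy m n mn; rewrite lee_wpmul2r ?lee_fin ?g_ge0//.
  exact/lefP/nd_nnsfun_approx.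
Qed.

End integral_of_density.


(** * The interval of angles *)

Lemma measurable_angles (R : realType) (bl br : bool) (a : R) :
  measurable (angles bl br a).
Proof. exact: measurable_itv. Qed.

(** Provides an incoming angle whichever endpoints are included; the properties of [rhoCt] are read
    off from [rhoCi] at such an angle. *)
Lemma angles_midpoint (R : realType) (bl br : bool) (a : R) :
  angles bl br a (a + pi).
Proof.
have pi0 : 0 < pi :> R := pi_gt0 R.
have lo : a < a + pi by rewrite ltrDl.
have hi : a + pi < a + pi *+ 2 by rewrite ltrD2l mulr2n ltrDl.
by case: bl; case: br; rewrite /angles /= in_itv /=; apply/andP; split; rewrite // ltW.
Qed.

(** * Data common to the identical elements *)

Section identical_elements.
Context (R : realType) (M : nat) (D : set R).
Variables (PTi : 'I_M -> R -> R -> R) (rhoCi : 'I_M -> R -> R -> R -> R).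
Variables (PT rhoCt : R -> R -> R).
Hypotheses (mD : measurable D) (D_neq0 : exists t, D t).
Hypothesis elements : forall i, polarization_element D (PTi i) (rhoCi i).
Hypothesis identical : case3 D PTi rhoCi PT rhoCt.
Variable i0 : 'I_M.

Lemma measurable_common_trans a : measurable_fun D (PT^~ a).
Proof.
apply: (eq_measurable_fun (PTi i0 ^~ a)); last exact: trans_measurable.
by move=> t; rewrite inE => Dt; rewrite identical.1.
Qed.

Lemma common_trans_prob t a : D t -> 0 <= PT t a <= 1.
Proof.
by move=> Dt; rewrite -(identical.1 i0)//; exact: (trans_prob (elements i0)).
Qed.

(** Freezing the incoming angle at a point of [D] makes [rhoCt] a section of a jointly measurable
    function. *)
Lemma measurable_common_change a : measurable_fun D (rhoCt^~ a).
Proof.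
have [t0 Dt0] := D_neq0.
apply: (eq_measurable_fun (fun t => rhoCi i0 t0 t a)).
  by move=> t; rewrite inE => Dt; rewrite identical.2.
apply: (@measurable_comp _ _ _ _ _ _ (D `*` D)
  (fun p : R * R => rhoCi i0 p.1 p.2 a) D (pair t0)).
- exact: measurableX.
- by move=> _ [t Dt <-].
- exact: change_measurable.
- by apply: measurable_funTS; exact: pair1_measurable.
Qed.

Lemma common_change_ge0 t a : D t -> 0 <= rhoCt t a.
Proof.
by move=> Dt; rewrite -(identical.2 i0 t)//; exact: (change_ge0 (elements i0)).
Qed.

Lemma common_change_int1 a :
  (\int[lebesgue_measure]_(t in D) (rhoCt t a)%:E = 1)%E.
Proof.
have [t0 Dt0] := D_neq0.
rewrite -(change_int1 (elements i0) a Dt0); apply: eq_integral => t.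
by rewrite inE => Dt; rewrite identical.2.
Qed.

Lemma integrable_common_change a :
  lebesgue_measure.-integrable D (EFin \o rhoCt^~ a).
Proof.
apply/integrableP; split.
  by apply/measurable_EFinP; exact: measurable_common_change.
under eq_integral => t.
  rewrite inE => Dt /=; rewrite ger0_norm ?common_change_ge0//; over.
by rewrite common_change_int1 ltry.
Qed.

(** * The course of a single photon *)

Context d (Omega : measurableType d) (P : probability Omega R).
Variables (rhoS0 : R -> R) (alpha : M.-tuple R).
Variables (reach : nat -> set Omega) (theta : nat -> Omega -> R).
Hypothesis photon : photon_process P D PTi rhoCi rhoS0 alpha reach theta.

(** With [setT] as the event [H], the Markov identities become statements about [P (reach i.+1)] and
    [P (angle_event reach theta i.+1 B)]. *)
Lemma history_setT i : history reach theta i setT.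
Proof.
apply: sub_sigma_algebra; exists 0%N, setT; split => //.
by rewrite /angle_event (reach0 photon) setTI preimage_setT.
Qed.

Let p i := fine (P (reach i)).

Let pE i : (i <= M)%N -> (p i)%:E = P (reach i).
Proof.
by move=> iM; rewrite fineK// fin_num_measure//; exact: (reach_measurable photon).
Qed.

Let p_ge0 i : 0 <= p i.
Proof. exact: fine_ge0. Qed.

Lemma reachS_prob (i : 'I_M) :
  P (reach i.+1) =
  (\int[P]_(w in reach i) (PT (theta i w) (alpha`_i))%:E)%E.
Proof.
have := photon_transmission photon (history_setT i); rewrite !setTI => ->.
apply: eq_integral => w; rewrite inE => rw.
by rewrite identical.1//; apply: (theta_range photon) => //; exact: ltnW.
Qed.

(* The outgoing angle does not depend on the incoming one, so its law on the
   event of transmission is a multiple of the common change density. *)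
Lemma angle_eventS_prob (i : 'I_M) (B : set R) : measurable B ->
  P (angle_event reach theta i.+1 B) =
  ((p i.+1)%:E *
    \int[lebesgue_measure]_(t in D `&` B) (rhoCt t (alpha`_i))%:E)%E.
Proof.
move=> mB; have := photon_change photon (history_setT i) mB.
rewrite !setTI => ->.
(* The product becomes the integral of a constant over [reach i.+1], so that integrands can be
   compared pointwise. *)
rewrite pE// muleC -integral_cst; last exact: (reach_measurable photon).
apply: eq_integral => w; rewrite inE => rw; apply: eq_integral => t.
rewrite inE => -[Dt _]; rewrite identical.2//.
apply: (theta_range photon); first exact: ltnW.
exact: (reachS photon).
Qed.

Lemma angle_event_prob_of_density (i : nat) (rho : R -> R) (B : set R) :
  (i <= M)%N -> P (reach i) != 0%E -> state_density P D reach theta i rho ->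
  measurable B -> P (angle_event reach theta i B) =
  ((p i)%:E * \int[lebesgue_measure]_(t in D `&` B) (rho t)%:E)%E.
Proof.
move=> iM P0 rhoP mB; have [_ _ <-//] := rhoP P0.
have p0 : p i != 0 by rewrite -eqe pE.
rewrite /cond_prob -EFinM mulrCA mulfV// mulr1 {2}/angle_event.
rewrite setIA setIid fineK// fin_num_measure//.
exact: (theta_measurable photon iM) (reach_measurable photon iM) _ mB.
Qed.

(** The law of [theta i] on [reach i] has density [p i * g], and the transmission probability is
    integrated against it. *)
Lemma integral_trans_of_density (i : nat) (g : R -> R) : (i <= M)%N ->
  measurable_fun D g -> (forall t, D t -> 0 <= g t) ->
  (forall B, measurable B -> P (angle_event reach theta i B) =
    (p i)%:E * \int[lebesgue_measure]_(t in D `&` B) (g t)%:E)%E ->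
  forall a, fine (\int[P]_(w in reach i) (PT (theta i w) a)%:E)%E =
    p i * \int[lebesgue_measure]_(t in D) (g t * PT t a).
Proof.
move=> iM mg g0 law a.
have PT0 t : D t -> 0 <= PT t a by move=> /(common_trans_prob _ a)/andP[].
have mPT := measurable_common_trans a.
have -> : (\int[P]_(w in reach i) (PT (theta i w) a)%:E =
    \int[lebesgue_measure]_(t in D) ((PT t a)%:E * (p i * g t)%:E))%E.
  apply: (integral_comp_density _ _ _ _ _ P lebesgue_measure (reach i) D
    (theta i) (fun t => p i * g t) _ _ _ _ _ _ _ (PT^~ a)) => //.
  - exact: (reach_measurable photon).
  - exact: (theta_measurable photon).
  - by move=> w; exact: (theta_range photon).
  - exact: measurable_funM.
  - by move=> t Dt; rewrite mulr_ge0// g0.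
  - move=> B mB; rewrite -[LHS]/(P (angle_event reach theta i B)) law//.
    rewrite -ge0_integralZl//; first exact: measurableI.
    + by apply/measurable_EFinP; apply: measurable_funS mg => // t [].
    + by move=> t [Dt _]; rewrite lee_fin g0.
    + by rewrite lee_fin.
(* The real integral is [fine] of an extended one, so [p i] moves inside [fine] and then under the
   integral sign. *)
rewrite -fine_mulEFin -ge0_integralZl//.
- congr fine; apply: eq_integral => t _; rewrite -!EFinM; congr EFin.
  by rewrite mulrC mulrA.
- exact/measurable_EFinP/measurable_funM.
- by move=> t Dt; rewrite lee_fin mulr_ge0 ?g0 ?PT0.
- by rewrite lee_fin.
Qed.

(** By induction: [rhoS0] gives the first factor. After element [i] the angle has density [rhoCt] at
    [alpha_i], and transmission at [alpha_(i+1)] contributes the factor [j = i.+1]. *)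
Lemma reach_prob (i : nat) : (i < M)%N ->
  p i.+1 = (\int[lebesgue_measure]_(t in D) (rhoS0 t * PT t (alpha`_0))) *
    \prod_(1 <= j < i.+1) (\int[lebesgue_measure]_(t in D)
       (rhoCt t (alpha`_(j.-1)) * PT t (alpha`_j))).
Proof.
elim: i => [|i IH] iM; rewrite /p (reachS_prob (Ordinal iM)).
  have P0 : P (reach 0%N) = 1%E by rewrite (reach0 photon) probability_setT.
  have p0 : p 0%N = 1 by rewrite /p P0.
  have P0_neq0 : P (reach 0%N) != 0%E by rewrite P0 oner_neq0.
  have [mS0 S0_ge0 _] := photon_source photon P0_neq0.
  rewrite big_geq// mulr1 (integral_trans_of_density 0 rhoS0)// ?p0 ?mul1r// => B mB.
  by rewrite -p0; apply: angle_event_prob_of_density => //; exact: photon_source photon.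
rewrite (integral_trans_of_density i.+1 (rhoCt^~ (alpha`_i)))//.
- by rewrite (IH (ltnW iM)) [in RHS]big_nat_recr//= mulrA.
- exact: ltnW.
- exact: measurable_common_change.
- by move=> t; exact: common_change_ge0.
- by move=> B mB; rewrite (angle_eventS_prob (Ordinal (ltnW iM))).
Qed.

(** If the surface is almost never reached, both sides vanish. Otherwise, cancelling [p i.+1] shows
    that both densities have the same integral over every measurable subset of [D]. *)
Lemma density_after_element (i : 'I_M) (rho : R -> R) :
  state_density P D reach theta i.+1 rho ->
  {ae lebesgue_measure, forall t, D t ->
    p i.+1 * rho t = p i.+1 * rhoCt t (alpha`_i)}.
Proof.
move=> rhoP; have [P0|P0] := eqVneq (P (reach i.+1)) 0%E.
  by apply: aeW => t _; rewrite /p P0 !mul0r.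
have [mrho _ _] := rhoP P0.
have p0 : p i.+1 != 0 by rewrite -eqe pE.
(* [integral_ae_eq] asks integrability of its first function, here [rhoCt], whose integral is 1. *)
have : ae_eq lebesgue_measure D (EFin \o rhoCt^~ (alpha`_i)) (EFin \o rho).
  apply: integral_ae_eq => //.
  - exact: integrable_common_change.
  - exact/measurable_EFinP.
  - move=> E ED mE; have DE : D `&` E = E by rewrite setIidr.
    have := angle_event_prob_of_density _ _ _ (ltn_ord i) P0 rhoP mE.
    rewrite angle_eventS_prob// DE => /(congr1 (fun x => (p i.+1)^-1%:E * x)%E).
    by rewrite !muleA -EFinM mulVf// !mul1e.
by apply: filterS => t /[apply] -[->].
Qed.

End identical_elements.

(** * From one photon to the beam *)

Lemma expected_photonsE d (Omega : measurableType d) (R : realType)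
    (P : probability Omega R) (N0 : nat) (reach : 'I_N0 -> nat -> set Omega)
    (i : nat) (p : R) :
  (forall k, measurable (reach k i)) -> (forall k, fine (P (reach k i)) = p) ->
  expected_photons P reach i = N0%:R * p.
Proof.
move=> mreach preach; rewrite /expected_photons unlock.
(* Linearity of expectation: each indicator contributes the same [p]. *)
under eq_integral do rewrite -sumEFin.
rewrite ge0_integral_sum//; last first.
  by move=> k; exact/measurable_EFinP/measurable_indic.
under eq_bigr do rewrite integral_indic// setIT.
rewrite (eq_bigr (fun=> p%:E)); last first.
  by move=> k _; rewrite -(preach k) fineK// fin_num_measure.
by rewrite sumEFin /= sumr_const card_ord mulr_natl.
Qed.

Theorem mainTheorem9
  (R : realType) (bl br : bool) (a : R) (M N0 : nat)
  (M_ge1 : (1 <= M)%N) (N0_gt0 : (0 < N0)%N)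
  (rhoS0 : R -> R)
  (PTi : 'I_M -> R -> R -> R) (rhoCi : 'I_M -> R -> R -> R -> R)
  (elements : forall i, polarization_element (angles bl br a) (PTi i) (rhoCi i))
  (PT rhoCt : R -> R -> R)
  (identical : case3 (angles bl br a) PTi rhoCi PT rhoCt)
  (alpha : M.-tuple R)
  (d : measure_display) (Omega : measurableType d) (P : probability Omega R)
  (reach : 'I_N0 -> nat -> set Omega) (theta : 'I_N0 -> nat -> Omega -> R)
  (beam : photon_beam P (angles bl br a) PTi rhoCi rhoS0 alpha reach theta)
  (rhoS : nat -> R -> R)
  (rhoS_0 : rhoS 0%N = rhoS0)
  (rhoS_density : forall (i : nat) (k : 'I_N0), (i <= M)%N ->
     state_density P (angles bl br a) (reach k) (theta k) i (rhoS i)) :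
  forall i : 'I_M,
  {ae lebesgue_measure, forall t : R, angles bl br a t ->
    expected_photons P reach i.+1 / N0%:R * rhoS i.+1 t =
    rhoCt t (alpha`_i) *
    (\int[lebesgue_measure]_(t0 in angles bl br a)
        (rhoS 0%N t0 * PT t0 (alpha`_0))) *
    \prod_(1 <= j < i.+1)
      (\int[lebesgue_measure]_(tj in angles bl br a)
          (rhoCt tj (alpha`_(j.-1)) * PT tj (alpha`_j)))}.
Proof.
move=> i.
have mD := measurable_angles R bl br a.
have D0 : exists t, angles bl br a t by exists (a + pi); exact: angles_midpoint.
(* All photons share [rhoS], so a single one identifies [rhoS i.+1]. *)
pose k0 := Ordinal N0_gt0.
(* The value obtained does not depend on [k], as [expected_photonsE] requires. *)
have reachP k := reach_prob _ _ _ _ _ _ _ mD D0 elements identical i _ _ _ _ _ _ _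
  (beam_photon beam k) i (ltn_ord i).
rewrite (expected_photonsE _ _ _ _ _ _ _ _ _ reachP); last first.
  by move=> k; exact: (reach_measurable (beam_photon beam k)).
have rhoSP := density_after_element _ _ _ _ _ _ _ mD D0 elements identical i
  _ _ _ _ _ _ _ (beam_photon beam k0) i (rhoS i.+1) (rhoS_density i.+1 k0 (ltn_ord i)).
apply: filterS rhoSP; first exact: (ae_filter_ringOfSetsType lebesgue_measure).
move=> t /[apply]; rewrite reachP => rhoSE.
rewrite [N0%:R * _]mulrC mulfK ?pnatr_eq0 -?lt0n// rhoS_0.
by rewrite rhoSE mulrC mulrA.
Qed.
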